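(* Let $(W,Y,m)$ be a continuity space and let $\sim$ be an equivalence relation on $Y$. Put $X=Y/{\sim}$, $U=(W_\prec)^Y$ (the set of all functions $Y\to W_\prec$) and $V=\Omega(U)$. For $a,b\in X$ let $d(a,b)\in V$ be the collection of all $A\in[U]^{<\omega}$ such that for every $R\in A$ there is a finite sequence $x_1,\dots,x_n$ of points of $Y$ with $x_1$ a representative of $a$, $x_n$ a representative of $b$, and, for each $i\le n-1$, $x_i\sim x_{i+1}$ if $i$ is even and $x_{i+1}\in B_{R(x_i)}(x_i)$ if $i$ is odd. Then the continuity space $(V,X,d)$ generates the quotient space, i.e. the topology on $X$ generated by $(V,X,d)$ is the quotient topology of the topology on $Y$ generated by $(W,Y,m)$.
   Context: For a complete lattice $L$ with bottom $\bot$ and $x,y\in L$, write $y\succ x$ (equivalently $x\prec y$; ''$y$ is well above $x$'') if whenever $S\subseteq L$ and $x\ge\bigwedge S$, there is $s\in S$ with $y\ge s$. A value distributive lattice is a completely distributive complete lattice $L$ for which $L_\prec=\{a\in L\mid a\succ\bot\}$ is a filter. A value quantale is a value distributive lattice $V$ with an associative commutative binary operation $+:V\times V\to V$ such that $x+\bot=x$ for all $x\in V$ and $\bigwedge(x+S)=x+\bigwedge S$ for all $x\in V$, $S\subseteq V$. A continuity space $(V,X,d)$ consists of a value quantale $V$, a set $X$ and a function $d:X\times X\to V$ with $d(x,x)=\bot$ and $d(x,z)\le d(x,y)+d(y,z)$ for all $x,y,z\in X$. For a continuity space $(V,X,d)$ and $\epsilon\succ\bot$ put $B_\epsilon(x)=\{y\in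 X\mid d(x,y)\prec\epsilon\}$ (in the claim, $B_{R(x_i)}(x_i)$ is a ball in $(W,Y,m)$). The topology generated by $(V,X,d)$ consists of those $O\subseteq X$ such that for every $x\in O$ there is $\epsilon\succ\bot$ with $B_\epsilon(x)\subseteq O$. For a set $Z$, $[Z]^{<\omega}$ is the set of finite subsets of $Z$, and $\Omega(Z)$ is the set of all $A\subseteq[Z]^{<\omega}$ that are downwards closed ($B\subseteq C\in A$ implies $B\in A$). Ordered by reverse inclusion, with $+$ given by intersection, $\Omega(Z)$ is a value quantale in which $p\succ\bot$ if and only if $p$ is finite. *)

(* Defs.v *)
From HB Require Import structures.
From mathcomp Require Import all_boot all_order finmap all_classical.
From mathcomp Require Import topology_structure quotient_topology.

Set Implicit Arguments.
Unset Strict Implicit.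
Unset Printing Implicit Defensive.

Import Order.TTheory.
Local Open Scope classical_set_scope.
Local Open Scope order_scope.
Local Open Scope quotient_scope.

HB.mixin Record isCompleteLattice d (L : Type) of Order.TBLattice d L := {
  infimum : set L -> L;
  infimum_lb : forall S : set L, lbound S (infimum S);
  infimum_glb : forall (S : set L) (x : L), lbound S x -> x <= infimum S
}.

#[short(type="completeLatticeType")]
HB.structure Definition CompleteLattice d :=
  {L of isCompleteLattice d L & Order.TBLattice d L}.

Section CompleteLatticeTheory.
Context {d : Order.disp_t} {L : completeLatticeType d}.
Implicit Types (x y : L) (S : set L).

Definition supremum S : L := infimum (ubound S).

Lemma supremum_ub S : ubound S (supremum S).
Proof. by move=> x Sx; apply: infimum_glb => y; apply. Qed.

Lemma supremum_lub S x : ubound S x -> supremum S <= x.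
Proof. exact: infimum_lb. Qed.

Definition well_above y x : Prop :=
  forall S, infimum S <= x -> exists2 s, S s & s <= y.

Definition positive : set L := [set a | well_above a \bot].

Definition completely_distributive : Prop :=
  forall (J : Type) (K : J -> Type) (x : forall j, K j -> L),
    infimum (range (fun j => supremum (range (x j)))) =
    supremum (range (fun f : forall j, K j =>
      infimum (range (fun j => x j (f j))))).

(* No properness condition: a filter may be the whole lattice, as happens for
   the positive elements of [Omega Z] when [Z] is finite. *)
Definition lattice_filter (F : set L) : Prop :=
  [/\ F \top,
      (forall x y, x <= y -> F x -> F y) &
      (forall x y, F x -> F y -> F (x `&` y))].

End CompleteLatticeTheory.

Arguments positive {d} L.
Arguments completely_distributive {d} L.

HB.mixin Record isValueDistributive d (L : Type) of CompleteLattice d L := {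
  value_distributive : completely_distributive L;
  positive_filter : lattice_filter (positive L)
}.

#[short(type="valueDistributiveType")]
HB.structure Definition ValueDistributive d :=
  {L of isValueDistributive d L & CompleteLattice d L}.

HB.mixin Record isValueQuantale d (V : Type) of ValueDistributive d V := {
  qadd : V -> V -> V;
  qaddA : associative qadd;
  qaddC : commutative qadd;
  qaddx0 : forall x : V, qadd x \bot = x;
  qadd_infimum : forall (x : V) (S : set V),
    infimum [set qadd x s | s in S] = qadd x (infimum S)
}.

#[short(type="valueQuantaleType")]
HB.structure Definition ValueQuantale d :=
  {V of isValueQuantale d V & ValueDistributive d V}.

Section ContinuitySpaces.
Context {disp : Order.disp_t} {V : valueQuantaleType disp}.

Record continuity_space (X : Type) (d : X -> X -> V) : Prop := {
  cdist_refl : forall x, d x x = \bot;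
  cdist_triangle : forall x y z, d x z <= qadd (d x y) (d y z)
}.

Definition cball (X : Type) (d : X -> X -> V) (eps : V) (x : X) : set X :=
  [set y | well_above eps (d x y)].

Definition copen (X : Type) (d : X -> X -> V) : set_system X :=
  [set O | forall x, O x ->
    exists2 eps, positive V eps & cball d eps x `<=` O].

Lemma well_above_le (x y z : V) : well_above y x -> y <= z -> well_above z x.
Proof.
by move=> yx yz S /yx[s Ss sy]; exists s => //; exact: le_trans yz.
Qed.

Section GeneratedTopology.
Context {X : choiceType} (d : X -> X -> V).

Lemma copenT : copen d setT.
Proof. by move=> x _; exists \top => //; have [] := @positive_filter _ V. Qed.

Lemma copenI : setI_closed (copen d).
Proof.
move=> A B oA oB x [/oA[a a0 aA] /oB[b b0 bB]].
have [_ _ posI] := @positive_filter _ V.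
exists (a `&` b); first exact: posI.
move=> y yab; split; [apply: aA | apply: bB]; apply: well_above_le yab _.
- exact: leIl.
- exact: leIr.
Qed.

Lemma copen_bigcup (I : Type) (f : I -> set X) :
  (forall i, copen d (f i)) -> copen d (\bigcup_i f i).
Proof.
move=> of_ x [i _ fix_]; have [eps eps0 epsf] := of_ i x fix_.
by exists eps => // y /epsf fiy; exists i.
Qed.

End GeneratedTopology.
End ContinuitySpaces.

(* A copy of [X] carrying the topology generated by [d], whose open sets are
   exactly [copen d]. *)
Definition generated_space {disp} {V : valueQuantaleType disp} {X : Type}
  (d : X -> X -> V) : Type := X.

Section GeneratedSpace.
Context {disp : Order.disp_t} {V : valueQuantaleType disp}.
Context {X : choiceType} (d : X -> X -> V).

HB.instance Definition _ := Choice.copy (generated_space d) X.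
HB.instance Definition _ := isOpenTopological.Build (generated_space d)
  (copenT d) (@copenI _ _ _ d) (@copen_bigcup _ _ _ d).

Lemma generated_openE : @open (generated_space d) = copen d.
Proof. by []. Qed.

End GeneratedSpace.

Local Open Scope fset_scope.

Record Omega (Z : choiceType) := MkOmega {
  omega_set :> {fset Z} -> Prop;
  omega_down : forall B C : {fset Z}, B `<=` C -> omega_set C -> omega_set B
}.

Section OmegaInstances.
Local Open Scope classical_set_scope.
Context {Z : choiceType}.
Implicit Types (p q : Omega Z) (S : set (Omega Z)) (A B C : {fset Z}).

Lemma omegaP p q : (forall A, p A <-> q A) -> p = q.
Proof.
case: p q => [p dp] [q dq] /= pq.
have {pq} pq : p = q by apply/funext => A; exact/propext.
by case: q / pq in dq *; congr MkOmega; exact: Prop_irrelevance.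
Qed.

HB.instance Definition _ := gen_eqMixin (Omega Z).
HB.instance Definition _ := gen_choiceMixin (Omega Z).

(* Reverse inclusion. *)
Definition omega_le p q : bool := `[< (omega_set q : set _) `<=` omega_set p >].

Fact omega_le_refl : reflexive omega_le.
Proof. by move=> p; apply/asboolP. Qed.

Fact omega_le_anti : antisymmetric omega_le.
Proof.
by move=> p q /andP[/asboolP qp /asboolP pq]; apply: omegaP => A; split=> [/pq|/qp].
Qed.

Fact omega_le_trans : transitive omega_le.
Proof.
by move=> q p r /asboolP qp /asboolP rq; apply/asboolP; exact: subset_trans qp.
Qed.

Fact omega_display : Order.disp_t. Proof. exact: Order.Disp tt tt. Qed.

HB.instance Definition _ := Order.Le_isPOrder.Build omega_display (Omega Z)
  omega_le_refl omega_le_anti omega_le_trans.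

Lemma omega_leP p q : reflect (forall A, q A -> p A) (p <= q).
Proof. exact: asboolP. Qed.

Definition omega_inf S : Omega Z.
Proof.
exists [set A | exists2 p, S p & p A].
by move=> B C BC [p Sp pC]; exists p => //; exact: omega_down BC pC.
Defined.

Definition omega_meet p q : Omega Z.
Proof.
exists [set A | p A \/ q A].
by move=> B C BC [] h; [left|right]; exact: omega_down BC h.
Defined.

Definition omega_join p q : Omega Z.
Proof.
exists [set A | p A /\ q A].
by move=> B C BC [pC qC]; split; [exact: omega_down BC pC|exact: omega_down BC qC].
Defined.

Definition omega_bot : Omega Z.
Proof. by exists [set: {fset Z}]. Defined.

Definition omega_top : Omega Z.
Proof. by exists set0. Defined.

Fact omega_meetP p q r : (p <= omega_meet q r) = (p <= q) && (p <= r).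
Proof.
apply/omega_leP/andP => [h|[/omega_leP pq /omega_leP pr] A []]; last 2 first.
- exact: pq.
- exact: pr.
by split; apply/omega_leP => A hA; apply: h; [left|right].
Qed.

Fact omega_joinP p q r : (omega_join p q <= r) = (p <= r) && (q <= r).
Proof.
apply/omega_leP/andP => [h|[/omega_leP pr /omega_leP qr] A rA].
  by split; apply/omega_leP => A /h[].
by split; [exact: pr|exact: qr].
Qed.

HB.instance Definition _ := Order.POrder_MeetJoin_isLattice.Build
  omega_display (Omega Z) omega_meetP omega_joinP.

Fact omega_le0x p : omega_bot <= p.
Proof. exact/omega_leP. Qed.

Fact omega_lex1 p : p <= omega_top.
Proof. exact/omega_leP. Qed.

HB.instance Definition _ :=
  Order.hasBottom.Build omega_display (Omega Z) omega_le0x.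
HB.instance Definition _ :=
  Order.hasTop.Build omega_display (Omega Z) omega_lex1.

Fact omega_inf_lb S : lbound S (omega_inf S).
Proof. by move=> p Sp; apply/omega_leP => A pA; exists p. Qed.

Fact omega_inf_glb S p : lbound S p -> p <= omega_inf S.
Proof. by move=> pS; apply/omega_leP => A [q /pS/omega_leP]; apply. Qed.

HB.instance Definition _ := isCompleteLattice.Build
  omega_display (Omega Z) omega_inf_lb omega_inf_glb.

Lemma omega_infE S A : infimum S A <-> exists2 p, S p & p A.
Proof. by []. Qed.

Lemma omega_supE S A : supremum S A <-> forall p, S p -> p A.
Proof.
split=> [SA p Sp|SA]; first by have /omega_leP := supremum_ub Sp; apply.
have dA B C : (B `<=` C)%fset -> (C `<=` A)%fset -> (B `<=` A)%fset.
  exact: fsubset_trans.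
suff : supremum S <= @MkOmega Z [set B | (B `<=` A)%fset] dA.
  by move/omega_leP; apply => /=; exact: fsubset_refl.
apply: supremum_lub => p Sp; apply/omega_leP => B /= BA.
exact: omega_down BA (SA p Sp).
Qed.

Fact omega_completely_distributive : completely_distributive (Omega Z).
Proof.
move=> J K x; apply: omegaP => A; split.
  move/omega_infE => [_ [j _ <-] /omega_supE xA].
  apply/omega_supE => _ [f _ <-]; apply/omega_infE.
  by exists (x j (f j)); [exists j|apply: xA; exists (f j)].
move/omega_supE => h; apply: contrapT => nA.
have /(_ _)/cid f : forall j, exists k, ~ x j k A.
  move=> j; apply: contrapT => /forallNP xA; apply: nA; apply/omega_infE.
  exists (supremum (range (x j))); first by exists j.
  by apply/omega_supE => _ [k _ <-]; apply: contrapT; exact: xA.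
have /h/omega_infE : range (fun f : forall j, K j =>
    infimum (range (fun j => x j (f j)))) (infimum (range (fun j => x j (sval (f j))))).
  by exists (fun j => sval (f j)).
by case=> _ [j _ <-]; exact: (svalP (f j)).
Qed.

Lemma omega_positiveP p :
  positive (Omega Z) p <-> exists C, forall A, p A -> (A `<=` C)%fset.
Proof.
split=> [p0|[C pC]].
  have dC C B B' : (B `<=` B')%fset -> (B' `<=` C)%fset -> (B `<=` C)%fset.
    exact: fsubset_trans.
  pose down C := @MkOmega Z [set B | (B `<=` C)%fset] (dC C).
  have /p0[_ [C _ <-] /omega_leP pC] : infimum (range down) <= \bot.
    apply/omega_leP => A _; apply/omega_infE.
    by exists (down A); [exists A|exact: fsubset_refl].
  by exists C.
move=> S /omega_leP /(_ C Logic.I) /omega_infE[s Ss sC]; exists s => //.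
by apply/omega_leP => A /pC subAC; exact: omega_down subAC sC.
Qed.

Lemma omega_positive_finite p : positive (Omega Z) p <-> finite_set (omega_set p).
Proof.
split=> [/omega_positiveP[C pC]|].
  apply: (@sub_finite_set _ _ [set` fpowerset C]) => [A /pC subAC|].
    by rewrite /= fpowersetE.
  exact: finite_fset.
move=> /finite_fsetP[P pP]; apply/omega_positiveP.
exists (\bigcup_(A <- P) A)%fset => A.
by rewrite pP /= => AP; exact: bigfcup_sup.
Qed.

Fact omega_positive_filter : lattice_filter (positive (Omega Z)).
Proof.
split=> [|p q /omega_leP pq /omega_positiveP[C pC]|].
- by apply/omega_positiveP; exists fset0.
- by apply/omega_positiveP; exists C => A /pq/pC.
move=> p q /omega_positiveP[C pC] /omega_positiveP[D qD].
apply/omega_positiveP; exists (C `|` D)%fset => A [/pC|/qD] h.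
- exact: fsubset_trans h (fsubsetUl _ _).
- exact: fsubset_trans h (fsubsetUr _ _).
Qed.

HB.instance Definition _ := isValueDistributive.Build omega_display (Omega Z)
  omega_completely_distributive omega_positive_filter.

(* In the reverse inclusion order, intersection is the join. *)
Fact omega_joinA : associative omega_join.
Proof. by move=> p q r; exact: (@joinA _ (Omega Z)). Qed.

Fact omega_joinC : commutative omega_join.
Proof. by move=> p q; exact: (@joinC _ (Omega Z)). Qed.

Fact omega_joinx0 p : omega_join p \bot = p.
Proof. exact: (@joinx0 _ (Omega Z)). Qed.

Fact omega_join_inf p S :
  infimum [set omega_join p s | s in S] = omega_join p (infimum S).
Proof.
apply: omegaP => A; split.
  by move=> /omega_infE[_ [s Ss <-] [pA sA]]; split => //; exists s.
move=> [pA /omega_infE[s Ss sA]]; apply/omega_infE.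
by exists (omega_join p s); [exists s|split].
Qed.

HB.instance Definition _ := isValueQuantale.Build omega_display (Omega Z)
  omega_joinA omega_joinC omega_joinx0 omega_join_inf.

End OmegaInstances.

Section QuotientDistance.
Context {disp : Order.disp_t} {W : valueQuantaleType disp}.
Context {Y : choiceType} (m : Y -> Y -> W) (e : equiv_rel Y).
Local Open Scope classical_set_scope.

Definition radius : choiceType := Y -> positive W.

(* The points of the sequence are [x 1, ..., x n]; the values of [x] at other
   indices are irrelevant. *)
Definition chained (R : radius) (a b : {eq_quot e}) : Prop :=
  exists (n : nat) (x : nat -> Y),
    [/\ (1 <= n)%N, \pi_{eq_quot e} (x 1) = a, \pi_{eq_quot e} (x n) = b &
        forall i : nat, (1 <= i <= n.-1)%N ->
          if odd i then cball m (val (R (x i))) (x i) (x i.+1)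
          else e (x i) (x i.+1)].

Definition quotient_dist (a b : {eq_quot e}) : Omega radius.
Proof.
exists [set A : {fset radius} | forall R : radius, R \in A -> chained R a b].
by move=> B C /fsubsetP BC h R /BC; exact: h.
Defined.

End QuotientDistance.

Arguments chained {disp W Y} m e R a b.
Arguments quotient_dist {disp W Y} m e a b.

(* Main.v *)
Require Import Defs.
From HB Require Import structures.
From mathcomp Require Import all_boot all_order finmap all_classical.
From mathcomp Require Import topology_structure quotient_topology.

(** Fix radii [R : Y -> positive W].  A _hop_ of [R] goes from the class of a
    point [x] to the class of any point of the ball of radius [R x] around [x],
    and an admissible sequence of points is a chain of hops read through its
    representatives.  So [chained R] is the reflexive transitive closure of
    [hop R] ([chainedP]); reflexivity and transitivity of these closures are
    the two axioms of a continuity space for the distance, because [+] on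
    [Omega] is intersection.

    The two topologies agree because a positive element of [Omega] involves
    only finitely many [R]'s.
    - If the preimage of [O] is open in [Y], openness supplies one [R] whose
      balls around the points of this preimage stay inside it.  Then [O] is
      stable under the hops of [R], hence under their chains, and so under the
      ball whose radius is the ideal of subsets of [{R}]
      ([hop_stable_copen]).
    - If [O] is open in the quotient distance, then around the class of [x] it
      contains all classes that are chained to it for every [R] in some finite
      set [C].  The meet of the finitely many [R x] is positive because
      positive elements form a filter, and the ball of this radius around [x]
      reaches only classes one hop away for every [R] in [C]
      ([copen_preimage]). *)

Set Implicit Arguments.
Unset Strict Implicit.
Unset Printing Implicit Defensive.

Import Order.TTheory.
Local Open Scope classical_set_scope.
Local Open Scope order_scope.
Local Open Scope quotient_scope.

Section WellAbove.
Context {d : Order.disp_t} {L : completeLatticeType d}.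

Lemma well_above_geq (x y : L) : well_above y x -> x <= y.
Proof.
have x1 : Defs.infimum [set x] <= x by exact: infimum_lb.
by move=> /(_ _ x1)[_ ->].
Qed.

Lemma filter_big_meet (F : set L) (I : eqType) (r : seq I) (f : I -> L) :
  lattice_filter F -> (forall i, i \in r -> F (f i)) ->
  exists2 a, F a & forall i, i \in r -> a <= f i.
Proof.
move=> [FT _ FI] Ff.
elim: r Ff => [|i r IHr] Ff; first by exists \top.
have [j jr|a Fa ar] := IHr; first by apply: Ff; rewrite inE jr orbT.
exists (f i `&` a); first by apply: FI => //; apply: Ff; rewrite inE eqxx.
move=> j; rewrite inE => /predU1P[->|/ar]; first exact: leIl.
exact: le_trans (leIr _ _).
Qed.

End WellAbove.

Section OmegaBalls.
Context {Z : choiceType}.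

(** Every positive element lies above one of these principal ideals, so balls
    with such radii suffice to generate a topology. *)
Definition omega_below (C : {fset Z}) : Omega Z.
Proof.
exists [set A | (A `<=` C)%fset] => A B AB.
exact: fsubset_trans.
Defined.

Lemma omega_below_positive C : positive (Omega Z) (omega_below C).
Proof. by apply/omega_positiveP; exists C. Qed.

Lemma positive_ge_omega_below (p : Omega Z) :
  positive (Omega Z) p -> exists C, omega_below C <= p.
Proof. by move=> /omega_positiveP[C pC]; exists C; apply/omega_leP. Qed.

(** A principal ideal is completely prime for unions: it lies in a union of
    downward closed families as soon as its generator does, hence in one of
    them.  So such an ideal is well above everything that it is above. *)
Lemma well_above_omega_below C (p : Omega Z) :
  well_above (omega_below C) p <-> p C.
Proof.
split=> [/well_above_geq/omega_leP|pC S /omega_leP Sp].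
  by apply; exact: fsubset_refl.
have /omega_infE[s Ss sC] := Sp C pC; exists s => //.
by apply/omega_leP => A subAC; exact: omega_down subAC sC.
Qed.

End OmegaBalls.

Section Chains.
Context {disp : Order.disp_t} {W : valueQuantaleType disp}.
Context {Y : choiceType} (m : Y -> Y -> W) (e : equiv_rel Y).
Implicit Types (R : @radius _ W Y) (a b c : {eq_quot e}).

Definition hop R a b : Prop := exists x y : Y,
  [/\ \pi_{eq_quot e} x = a, \pi_{eq_quot e} y = b &
      cball m (val (R x)) x y].

(** Closing under a last hop, rather than a first one, matches the growth of
    an indexed sequence at its end. *)
Inductive hops R a : {eq_quot e} -> Prop :=
| hops_refl : hops R a a
| hops_hop b c : hops R a b -> hop R b c -> hops R a c.

Lemma hops_trans R a b c : hops R a b -> hops R b c -> hops R a c.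
Proof. by move=> ab; elim=> // x y _ ax xy; exact: hops_hop xy. Qed.

Lemma hops_stable R (O : set {eq_quot e}) :
  (forall a b, O a -> hop R a b -> O b) -> forall a b, O a -> hops R a b -> O b.
Proof. by move=> Ohop a b Oa; elim=> // {}b c _ Ob /(Ohop _ _ Ob). Qed.

Lemma chained_hops R a b : chained m e R a b -> hops R a b.
Proof.
move=> [n [x [n1 <- <- xP]]].
case: n => // n in n1 xP *; elim: n => [|n IHn] in n1 xP *.
  exact: hops_refl.
have xSn : hops R (\pi_{eq_quot e} (x 1)) (\pi_{eq_quot e} (x n.+1)).
  by apply: IHn => // i /andP[i1 ilen]; apply: xP; rewrite i1 (leq_trans ilen).
have := xP n.+1 (leqnn _); case: ifP => _ xx; last first.
  by have /eqmodP <- : e (x n.+1) (x n.+2) by [].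
by apply: hops_hop xSn _; exists (x n.+1), (x n.+2).
Qed.

(** A chain is extended only at an even index, where the next step is a change
    of representative.  A chain of odd length is first made even by repeating
    its last point, which a ball of positive radius contains because the
    self-distance is [\bot]. *)
Lemma hops_chained (hm : continuity_space m) R a b :
  hops R a b -> chained m e R a b.
Proof.
have even_chain c : chained m e R a c -> exists (n : nat) (x : nat -> Y),
    [/\ (1 <= n)%N, ~~ odd n, \pi_{eq_quot e} (x 1) = a,
        \pi_{eq_quot e} (x n) = c &
        forall i : nat, (1 <= i <= n.-1)%N ->
          if odd i then cball m (val (R (x i))) (x i) (x i.+1)
          else e (x i) (x i.+1)].
  move=> [n [x [n1 xa xc xP]]]; have [on|en] := boolP (odd n); last by exists n, x.
  exists n.+1, (fun i => x (minn i n)); split => //=.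
  - by rewrite negbK.
  - by rewrite (minn_idPl n1).
  - by rewrite (minn_idPr (leqnSn n)).
  move=> i /andP[i1]; rewrite leq_eqVlt => /predU1P[->|iltn].
    rewrite on minnn (minn_idPr (leqnSn n)) /cball /= (cdist_refl hm).
    exact: set_mem (valP (R (x n))).
  rewrite (minn_idPl (ltnW iltn)) (minn_idPl iltn); apply: xP.
  by rewrite i1 -ltnS prednK.
elim=> [|{}b c _ /even_chain[n [x [n1 en xa xb xP]]] [y [z [yb zc yz]]]].
  by exists 1%N, (fun=> repr a); split; rewrite ?reprK // => -[].
exists n.+2, (fun i => if (i <= n)%N then x i else if i == n.+1 then y else z).
split=> //=.
- by rewrite n1.
- by rewrite ltnNge leqnSn /= eqn_leq ltnn.
move=> i /andP[i1]; rewrite leq_eqVlt => /predU1P[->|].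
  by rewrite /= en ltnn eqxx ltnNge leqnSn /= eqn_leq ltnn.
rewrite ltnS => ilen.
have /predU1P[->|iltn] : (i == n) || (i < n)%N by rewrite -leq_eqVlt.
  rewrite (negPf en) leqnn ltnn eqxx.
  by apply/(@eqmodP _ e); rewrite xb yb.
by rewrite ilen iltn; apply: xP; rewrite i1 -ltnS prednK.
Qed.

Lemma chainedP (hm : continuity_space m) R a b :
  chained m e R a b <-> hops R a b.
Proof. by split; [exact: chained_hops|exact: hops_chained]. Qed.

Lemma quotient_dist_continuity (hm : continuity_space m) :
  continuity_space (quotient_dist m e).
Proof.
split=> [a|a b c].
  by apply: omegaP => A; split=> // _ R _; apply/(chainedP hm)/hops_refl.
apply/omega_leP => A [abA bcA] R RA; apply/(chainedP hm).
apply: hops_trans (chained_hops (abA R RA)) (chained_hops (bcA R RA)).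
Qed.

(** Stability under the hops of a single [R] is enough, since the subsets of
    [{R}] form a positive element. *)
Lemma hop_stable_copen R (O : set {eq_quot e}) :
  (forall a b, O a -> hop R a b -> O b) -> copen (quotient_dist m e) O.
Proof.
move=> Ohop a Oa; exists (omega_below [fset R]%fset).
  exact: omega_below_positive.
move=> b /well_above_omega_below /(_ R); rewrite inE eqxx => /(_ isT) ab.
exact: hops_stable Ohop _ _ Oa (chained_hops ab).
Qed.

Lemma preimage_copen (O : set {eq_quot e}) :
  copen m (\pi_{eq_quot e} @^-1` O) -> copen (quotient_dist m e) O.
Proof.
move=> oO.
have /choice[R RP] : forall x, exists r : positive W,
    O (\pi_{eq_quot e} x) ->
    cball m (val r) x `<=` \pi_{eq_quot e} @^-1` O.
  move=> x; have [Ox|nOx] := pselect (O (\pi_{eq_quot e} x)).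
    by have [r r0 rO] := oO x Ox; exists (SigSub (mem_set r0)).
  (* Only the balls around points of the preimage of [O] are constrained. *)
  have [W1 _ _] := @positive_filter _ W.
  by exists (SigSub (mem_set W1)).
apply: (@hop_stable_copen R) => a b + [x [y [xa <- xy]]].
by rewrite -xa => /RP; exact.
Qed.

Lemma copen_preimage (hm : continuity_space m) (O : set {eq_quot e}) :
  copen (quotient_dist m e) O -> copen m (\pi_{eq_quot e} @^-1` O).
Proof.
move=> oO x /oO[p /positive_ge_omega_below[C Cp] pO].
have [r r0 rC] := @filter_big_meet _ _ _ _ (enum_fset C) (fun R => val (R x))
  positive_filter (fun R _ => set_mem (valP (R x))).
exists r => // y xy; apply: pO; apply: well_above_le Cp.
apply/well_above_omega_below => R RC; apply/(chainedP hm).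
apply: hops_hop (hops_refl _ _) _; exists x, y; split=> //.
exact: well_above_le xy (rC R RC).
Qed.

End Chains.

Theorem theorem14 (disp : Order.disp_t) (W : valueQuantaleType disp)
    (Y : choiceType) (m : Y -> Y -> W) (hm : continuity_space m)
    (e : equiv_rel Y) :
  continuity_space (quotient_dist m e) /\
  @open (generated_space (quotient_dist m e)) =
  @open (quotient_topology ({eq_quot e}%qT : quotType (generated_space m))).
Proof.
split; first exact: quotient_dist_continuity.
apply/seteqP; split=> O; first exact: copen_preimage.
exact: preimage_copen.
Qed.
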